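(* Let $X$ be an infinite set. (i) $\operatorname{rank}(\mathcal{PB}_X:\mathcal G_X)=2$. (ii) If $\alpha,\beta\in\mathcal{PB}_X$, then $\mathcal{PB}_X=\langle\mathcal G_X\cup\{\alpha,\beta\}\rangle$ if and only if, after possibly interchanging $\alpha$ and $\beta$, we have $\alpha\in\mathcal G_X^R$, $\beta\in\mathcal G_X^L$ and $h^*(\alpha)=h(\beta)=|X|$.
   Context: Partial Brauer monoid. Let $X$ be a set and $X'=\{x':x\in X\}$ a disjoint copy of $X$. A Brauer graph is an (undirected) graph with vertex set $X\cup X'$ in which every vertex has degree at most $1$; $\mathcal{PB}_X$ is the set of all of them. Product: let $X''=\{x'':x\in X\}$ be another disjoint copy of $X$; given $\alpha,\beta\in\mathcal{PB}_X$, let $\alpha^\vee$ be $\alpha$ with each vertex $x'$ renamed $x''$, let $\beta^\wedge$ be $\beta$ with each vertex $x\in X$ renamed $x''$, and let $\Pi(\alpha,\beta)$ be the graph on $X\cup X'\cup X''$ with all edges of $\alpha^\vee$ and $\beta^\wedge$. Then $\alpha\beta$ is the graph on $X\cup X'$ with an edge $\{x,y\}$ whenever $x,y\in X\cup X'$ are distinct and lie in the same connected component of $\Pi(\alpha,\beta)$. This makes $\mathcal{PB}_X$ a monoid with identity the graph with edge set $\{\{x,x'\}:x\in X\}$. For $\alpha\in\mathcal{PB}_X$, $h(\alpha)$ is the number of upper hooks of $\alpha$ (edges $\{x,y\}$ with $x,y\in X$ distinct) and $h^*(\alpha)$ is the number of lower hooks (edges $\{x',y'\}$ with $x,y\in X$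 distinct); these are cardinals. In a monoid $M$, an element $x$ is a left unit if $ax=1$ for some $a\in M$, a right unit if $xb=1$ for some $b\in M$, and a unit if it is both. $\mathcal G_X^L$, $\mathcal G_X^R$ and $\mathcal G_X=\mathcal G_X^L\cap\mathcal G_X^R$ denote the submonoids of all left units, right units, and units of $\mathcal{PB}_X$. For a subset $U$ of a semigroup $S$, $\langle U\rangle$ is the subsemigroup generated by $U$. For $A\subseteq S$, the relative rank is $\operatorname{rank}(S:A)=\min\{|U| : U\subseteq S,\ S=\langle A\cup U\rangle\}$. *)

(* Defs.v *)
From HB Require Import structures.
From Stdlib Require Import Relations.
From mathcomp Require Import all_boot.
From mathcomp Require Import boolp classical_sets functions cardinality.

Set Implicit Arguments.
Unset Strict Implicit.
Unset Printing Implicit Defensive.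

Export Algebra.
Local Open Scope classical_set_scope.
Local Open Scope card_scope.
Local Open Scope group_scope.

Definition left_units (M : monoidType) : set M := [set x | exists a, a * x = 1].
Definition right_units (M : monoidType) : set M := [set x | exists b, x * b = 1].
Arguments left_units : clear implicits.
Arguments right_units : clear implicits.
Definition units (M : monoidType) : set M := left_units M `&` right_units M.
Arguments units : clear implicits.

Definition subsemigroup (S : semigroupType) (A : set S) : Prop :=
  forall x y, A x -> A y -> A (x * y).

Definition generated (S : semigroupType) (U : set S) : set S :=
  smallest (@subsemigroup S) U.

(* Cardinals are represented by sets up to equipotence: [relative_rank A K]
   reads "rank(S : A) = |K|". *)
Definition relative_rank (S : semigroupType) (A : set S) T (K : set T) : Prop :=
  (exists2 U : set S, generated (A `|` U) = [set: S] & U #= K) /\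
  (forall U : set S, generated (A `|` U) = [set: S] -> K #<= U).

Local Close Scope group_scope.

(* The vertex set X ∪ X' is [X + X]: [inl x] stands for x, [inr x] for x'. *)
Record brauer (X : Type) := Brauer {
  edge : X + X -> X + X -> Prop;
  edge_sym : forall p q, edge p q -> edge q p;
  edge_irr : forall p, ~ edge p p;
  edge_deg : forall p q r, edge p q -> edge p r -> q = r
}.

Definition upper_hooks X (a : brauer X) : set (set X) :=
  [set e | exists x y, edge a (inl x) (inl y) /\ e = [set x; y]].
Definition lower_hooks X (a : brauer X) : set (set X) :=
  [set e | exists x y, edge a (inr x) (inr y) /\ e = [set x; y]].

(* Vertices of the product graph: x, x'' and x' respectively. *)
Inductive vertex3 (X : Type) := Up of X | Mid of X | Low of X.

Definition vee X (p : X + X) : vertex3 X :=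
  match p with inl x => Up x | inr x => Mid x end.
Definition wedge X (p : X + X) : vertex3 X :=
  match p with inl x => Mid x | inr x => Low x end.
Definition outer X (p : X + X) : vertex3 X :=
  match p with inl x => Up x | inr x => Low x end.

Definition vee_edge X (a : brauer X) (u v : vertex3 X) : Prop :=
  exists p q, [/\ u = vee p, v = vee q & edge a p q].
Definition wedge_edge X (b : brauer X) (u v : vertex3 X) : Prop :=
  exists p q, [/\ u = wedge p, v = wedge q & edge b p q].

Definition product_graph X (a b : brauer X) (u v : vertex3 X) : Prop :=
  vee_edge a u v \/ wedge_edge b u v.

(* [product_graph a b] is symmetric, so its connected components are the
   classes of its reflexive transitive closure. *)
Definition connected3 X (a b : brauer X) : vertex3 X -> vertex3 X -> Prop :=
  clos_refl_trans _ (product_graph a b).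

Definition mul_edge X (a b : brauer X) (p q : X + X) : Prop :=
  p <> q /\ connected3 a b (outer p) (outer q).

Definition one_edge X (p q : X + X) : Prop :=
  match p, q with
  | inl x, inr y => x = y
  | inr x, inl y => x = y
  | _, _ => False
  end.

Lemma brauerP X (a b : brauer X) : (forall p q, edge a p q <-> edge b p q) -> a = b.
Proof.
case: a b => [e s i d] [e' s' i' d'] /= H.
have E : e = e' by apply/funext => p; apply/funext => q; apply/propext.
by subst e'; congr Brauer; apply: Prop_irrelevance.
Qed.

Lemma vee_inj X : injective (@vee X).
Proof. by case=> x [] y //= [->]. Qed.
Lemma wedge_inj X : injective (@wedge X).
Proof. by case=> x [] y //= [->]. Qed.
Lemma outer_inj X : injective (@outer X).
Proof. by case=> x [] y //= [->]. Qed.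

Lemma product_graph_sym X (a b : brauer X) u v :
  product_graph a b u v -> product_graph a b v u.
Proof.
by move=> [] [p [q [-> -> /edge_sym h]]]; [left|right]; exists q, p.
Qed.

Lemma connected3_sym X (a b : brauer X) u v :
  connected3 a b u v -> connected3 a b v u.
Proof.
elim=> [x y /product_graph_sym h|x|x y z _ h1 _ h2].
- exact: rt_step.
- exact: rt_refl.
- exact: rt_trans h2 h1.
Qed.

Section ProductDegree.
Variables (X : Type) (a b : brauer X).

Definition colored_edge (c : bool) : vertex3 X -> vertex3 X -> Prop :=
  if c then vee_edge a else wedge_edge b.

Lemma colored_edge_sym c u v : colored_edge c u v -> colored_edge c v u.
Proof.
by case: c => -[p [q [-> -> /edge_sym h]]]; exists q, p.
Qed.

Lemma colored_edge_deg c u v w :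
  colored_edge c u v -> colored_edge c u w -> v = w.
Proof.
case: c => -[p [q [-> -> h]]] [p' [q' [e -> h']]].
- by move/vee_inj: e => e; subst p'; rewrite (edge_deg h h').
- by move/wedge_inj: e => e; subst p'; rewrite (edge_deg h h').
Qed.

(* An alternating walk from [p], together with the colour its next edge must
   have. *)
Inductive alternating (p : X + X) : vertex3 X -> bool -> Prop :=
| alternating0 : alternating p (outer p) (if p is inl _ then true else false)
| alternatingS u v c :
    alternating p u c -> colored_edge c u v -> alternating p v (~~ c).

Lemma outer_color p c v :
  colored_edge c (outer p) v -> c = (if p is inl _ then true else false).
Proof.
by case: c p => -[] x [[] y [[] z [//= ]]].
Qed.

Lemma connected3_alternating p v :
  connected3 a b (outer p) v -> exists c, alternating p v c.
Proof.
move=> h; have {h} : clos_refl_trans_n1 _ (product_graph a b) (outer p) v.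
  exact: clos_rt_rtn1.
elim=> [|y z hyz _ [c hc]]; first by eexists; exact: alternating0.
have [d hd] : exists d, colored_edge d y z.
  by case: hyz => h; [exists true|exists false].
case: (eqVneq d c) => [e|ne].
  by subst d; exists (~~ c); apply: alternatingS hc hd.
have ed : d = ~~ c by case: (d) (c) ne => [] [].
subst d; case: hc hd {ne hyz} => [|u w c' hu huv] hd.
  by move: (outer_color hd); case: (p).
rewrite negbK in hd; exists c'.
by rewrite -(colored_edge_deg (colored_edge_sym huv) hd).
Qed.

Lemma alternating_outer p q c : p <> q -> alternating p (outer q) c ->
  c = ~~ (if q is inl _ then true else false).
Proof.
move=> npq; move e : (outer q) => w h; case: h e => [/outer_inj|u v d _].
  by move=> e; case: npq.
by move=> h e; subst v; rewrite -(outer_color (colored_edge_sym h)).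
Qed.

Definition walk_step (s t : vertex3 X * bool) : Prop :=
  colored_edge s.2 s.1 t.1 /\ t.2 = ~~ s.2.

Lemma walk_step_det s t t' : walk_step s t -> walk_step s t' -> t = t'.
Proof.
case: t t' => [u c] [u' c'] [/= h ->] [/= h' ->].
by rewrite (colored_edge_deg h h').
Qed.

Lemma alternating_walk p u c : alternating p u c ->
  clos_refl_trans_1n _ walk_step
    (outer p, if p is inl _ then true else false) (u, c).
Proof.
elim=> [|{}u v {}c _ IH h]; first exact: rt1n_refl.
apply: clos_rt_rt1n; apply: rt_trans (clos_rt1n_rt _ _ _ _ IH) _.
exact: rt_step.
Qed.

Lemma walk_terminal s t t' :
  clos_refl_trans_1n _ walk_step s t -> clos_refl_trans_1n _ walk_step s t' ->
  (forall r, ~ walk_step t r) -> (forall r, ~ walk_step t' r) -> t = t'.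
Proof.
move=> h; elim: h t' => [{}s|s1 s2 s3 h12 _ IH] t' h'.
  by case: h' => // r r' h _ /(_ r).
case: h' IH => [|r r' h hr] IH ht ht'; first by case: (ht' s2).
by apply: IH => //; rewrite (walk_step_det h12 h).
Qed.

Lemma alternating_terminal p q c : p <> q -> alternating p (outer q) c ->
  forall r, ~ walk_step (outer q, c) r.
Proof.
move=> npq /(alternating_outer npq) -> r [/= /outer_color + _].
by case: (q).
Qed.

Lemma mul_edge_sym p q : mul_edge a b p q -> mul_edge a b q p.
Proof. by move=> [n /connected3_sym h]; split=> // /esym. Qed.

Lemma mul_edge_irr p : ~ mul_edge a b p p.
Proof. by case. Qed.

Lemma mul_edge_deg p q r : mul_edge a b p q -> mul_edge a b p r -> q = r.
Proof.
move=> [nq /connected3_alternating [c hc]] [nr /connected3_alternating [d hd]].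
have := walk_terminal (alternating_walk hc) (alternating_walk hd)
  (alternating_terminal nq hc) (alternating_terminal nr hd).
by case=> /outer_inj.
Qed.

Definition brauer_mul : brauer X := Brauer mul_edge_sym mul_edge_irr mul_edge_deg.

End ProductDegree.

Definition brauer_one X : brauer X.
Proof.
by exists (@one_edge X) => [[x|x] [y|y]|[x|x]|[x|x] [y|y] [z|z]] //=; congruence.
Defined.

Section MonoidLaws.
Variable X : Type.
Implicit Types a b c : brauer X.


Lemma connected3_outer a b p q :
  connected3 a b (outer p) (outer q) <-> p = q \/ mul_edge a b p q.
Proof.
split=> [h|[->|[]//]]; last exact: rt_refl.
by case: (pselect (p = q)) => e; [left|right].
Qed.

(* In the four-layer graph of a, b, c (layers 0, 1, 2, 3), [embed i p]
   places a graph between layers i and i + 1. *)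
Let embed (i : nat) (p : X + X) : nat * X :=
  match p with inl x => (i, x) | inr x => (i.+1, x) end.
Let E4 a b c (u v : nat * X) : Prop :=
  exists p q, [\/ [/\ u = embed 0 p, v = embed 0 q & edge a p q],
                  [/\ u = embed 1 p, v = embed 1 q & edge b p q] |
                  [/\ u = embed 2 p, v = embed 2 q & edge c p q]].
Let out4 (p : X + X) : nat * X :=
  match p with inl x => (0, x) | inr x => (3, x) end.
Let C4 a b c := clos_refl_trans _ (E4 a b c).

Let map3 (i j k : nat) (u : vertex3 X) : nat * X :=
  match u with Up x => (i, x) | Mid x => (j, x) | Low x => (k, x) end.

Let lift_conn a b c d e (f : vertex3 X -> nat * X) :
  (forall u v, product_graph d e u v -> C4 a b c (f u) (f v)) ->
  forall u v, connected3 d e u v -> C4 a b c (f u) (f v).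
Proof.
move=> H u v; elim=> [x y /H //|x|x y z _ h1 _ h2]; first exact: rt_refl.
exact: rt_trans h1 h2.
Qed.

Let ab_C4 a b c u v : connected3 a b u v -> C4 a b c (map3 0 1 2 u) (map3 0 1 2 v).
Proof.
apply: lift_conn => {}u {}v [] [p [q [-> -> h]]]; apply: rt_step; exists p, q.
- by constructor 1; split=> //; [case: p {h}|case: q {h}].
- by constructor 2; split=> //; [case: p {h}|case: q {h}].
Qed.

Let bc_C4 a b c u v : connected3 b c u v -> C4 a b c (map3 1 2 3 u) (map3 1 2 3 v).
Proof.
apply: lift_conn => {}u {}v [] [p [q [-> -> h]]]; apply: rt_step; exists p, q.
- by constructor 2; split=> //; [case: p {h}|case: q {h}].
- by constructor 3; split=> //; [case: p {h}|case: q {h}].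
Qed.

Let abc_C4l a b c u v : connected3 (brauer_mul a b) c u v ->
  C4 a b c (map3 0 2 3 u) (map3 0 2 3 v).
Proof.
apply: lift_conn => {}u {}v [] [p [q [-> -> h]]].
  case: h => _ /(ab_C4 c); by case: p; case: q.
apply: rt_step; exists p, q.
by constructor 3; split=> //; [case: p {h}|case: q {h}].
Qed.

Let abc_C4r a b c u v : connected3 a (brauer_mul b c) u v ->
  C4 a b c (map3 0 1 3 u) (map3 0 1 3 v).
Proof.
apply: lift_conn => {}u {}v [] [p [q [-> -> h]]]; last first.
  case: h => _ /(bc_C4 a); by case: p; case: q.
apply: rt_step; exists p, q.
by constructor 1; split=> //; [case: p {h}|case: q {h}].
Qed.

Let vee_conn a b p q : p = q \/ edge a p q -> connected3 a b (vee p) (vee q).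
Proof.
case=> [->|h]; first exact: rt_refl.
by apply: rt_step; left; exists p, q.
Qed.

Let wedge_conn a b p q : p = q \/ edge b p q -> connected3 a b (wedge p) (wedge q).
Proof.
case=> [->|h]; first exact: rt_refl.
by apply: rt_step; right; exists p, q.
Qed.

Let C4_abcl a b c p v : C4 a b c (out4 p) v ->
  (exists2 u, v = map3 0 2 3 u & connected3 (brauer_mul a b) c (outer p) u) \/
  (exists x q, [/\ v = (1, x), connected3 (brauer_mul a b) c (outer p) (vee q)
     & connected3 a b (outer q) (Mid x)]).
Proof.
move=> h; have {h} : clos_refl_trans_n1 _ (E4 a b c) (out4 p) v.
  exact: clos_rt_rtn1.
elim=> [|y z hyz _ IH]; first by left; exists (outer p); [case: p|exact: rt_refl].
have outL q r : connected3 (brauer_mul a b) c (outer p) (vee q) ->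
    connected3 a b (outer q) (outer r) ->
    connected3 (brauer_mul a b) c (outer p) (vee r).
  by move=> h1 /connected3_outer h2; apply: rt_trans h1 _; apply: vee_conn.
have main r w : connected3 (brauer_mul a b) c (outer p) (vee r) ->
    connected3 a b (outer r) w -> z = map3 0 1 2 w ->
  (exists2 u, z = map3 0 2 3 u & connected3 (brauer_mul a b) c (outer p) u) \/
  (exists x q, [/\ z = (1, x), connected3 (brauer_mul a b) c (outer p) (vee q)
     & connected3 a b (outer q) (Mid x)]).
  move=> h1 h2 ->; case: w h2 => x h2 /=.
  - by left; exists (Up x) => //; apply: (outL r (inl x)).
  - by right; exists x, r.
  - by left; exists (Mid x) => //; apply: (outL r (inr x)).
have step w w' : product_graph a b w w' -> y = map3 0 1 2 w ->
    z = map3 0 1 2 w' ->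
  (exists2 u, z = map3 0 2 3 u & connected3 (brauer_mul a b) c (outer p) u) \/
  (exists x q, [/\ z = (1, x), connected3 (brauer_mul a b) c (outer p) (vee q)
     & connected3 a b (outer q) (Mid x)]).
  move=> /(rt_step _ _ _ _) hw ey ez; case: IH => [[u eu hu]|[x [q [ex h1 h2]]]].
  - rewrite eu in ey; case: w ey hw => x; case: u eu hu => t _ hu //= [e] hw;
      subst t.
    + exact: (main (inl x) w').
    + exact: (main (inr x) w').
  - rewrite ex in ey; case: w ey hw => t //= [e] hw; subst t.
    by apply: (main q w') => //; apply: rt_trans h2 hw.
case: hyz => s [t [] [ey ez h]].
- apply: (step (vee s) (vee t)); first by left; exists s, t.
  + by rewrite ey; case: (s).
  + by rewrite ez; case: (t).
- apply: (step (wedge s) (wedge t)); first by right; exists s, t.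
  + by rewrite ey; case: (s).
  + by rewrite ez; case: (t).
left; exists (wedge t); first by rewrite ez; case: (t).
case: IH => [[u eu hu]|[x [q [ex _ _]]]].
  have eus : u = wedge s.
    by move: eu; rewrite ey; case: (s) => x; case: (u) => r //= [->].
  by subst u; apply: rt_trans hu _; apply: wedge_conn; right.
- by move: ex; rewrite ey; case: (s).
Qed.

Let C4_abcr a b c p v : C4 a b c (out4 p) v ->
  (exists2 u, v = map3 0 1 3 u & connected3 a (brauer_mul b c) (outer p) u) \/
  (exists x q, [/\ v = (2, x), connected3 a (brauer_mul b c) (outer p) (wedge q)
     & connected3 b c (outer q) (Mid x)]).
Proof.
move=> h; have {h} : clos_refl_trans_n1 _ (E4 a b c) (out4 p) v.
  exact: clos_rt_rtn1.
elim=> [|y z hyz _ IH]; first by left; exists (outer p); [case: p|exact: rt_refl].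
have outL q r : connected3 a (brauer_mul b c) (outer p) (wedge q) ->
    connected3 b c (outer q) (outer r) ->
    connected3 a (brauer_mul b c) (outer p) (wedge r).
  by move=> h1 /connected3_outer h2; apply: rt_trans h1 _; apply: wedge_conn.
have main r w : connected3 a (brauer_mul b c) (outer p) (wedge r) ->
    connected3 b c (outer r) w -> z = map3 1 2 3 w ->
  (exists2 u, z = map3 0 1 3 u & connected3 a (brauer_mul b c) (outer p) u) \/
  (exists x q, [/\ z = (2, x), connected3 a (brauer_mul b c) (outer p) (wedge q)
     & connected3 b c (outer q) (Mid x)]).
  move=> h1 h2 ->; case: w h2 => x h2 /=.
  - by left; exists (Mid x) => //; apply: (outL r (inl x)).
  - by right; exists x, r.
  - by left; exists (Low x) => //; apply: (outL r (inr x)).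
have step w w' : product_graph b c w w' -> y = map3 1 2 3 w ->
    z = map3 1 2 3 w' ->
  (exists2 u, z = map3 0 1 3 u & connected3 a (brauer_mul b c) (outer p) u) \/
  (exists x q, [/\ z = (2, x), connected3 a (brauer_mul b c) (outer p) (wedge q)
     & connected3 b c (outer q) (Mid x)]).
  move=> /(rt_step _ _ _ _) hw ey ez; case: IH => [[u eu hu]|[x [q [ex h1 h2]]]].
  - rewrite eu in ey; case: w ey hw => x; case: u eu hu => t _ hu //= [e] hw;
      subst t.
    + exact: (main (inl x) w').
    + exact: (main (inr x) w').
  - rewrite ex in ey; case: w ey hw => t //= [e] hw; subst t.
    by apply: (main q w') => //; apply: rt_trans h2 hw.
case: hyz => s [t [] [ey ez h]]; last first.
- apply: (step (wedge s) (wedge t)); first by right; exists s, t.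
  + by rewrite ey; case: (s).
  + by rewrite ez; case: (t).
- apply: (step (vee s) (vee t)); first by left; exists s, t.
  + by rewrite ey; case: (s).
  + by rewrite ez; case: (t).
left; exists (vee t); first by rewrite ez; case: (t).
case: IH => [[u eu hu]|[x [q [ex _ _]]]].
- have eus : u = vee s.
    by move: eu; rewrite ey; case: (s) => x; case: (u) => r //= [->].
  by subst u; apply: rt_trans hu _; apply: vee_conn; right.
- by move: ex; rewrite ey; case: (s).
Qed.

Lemma brauer_mulA : associative (@brauer_mul X).
Proof.
move=> a b c; apply: brauerP => p q; split=> -[n h]; split=> //.
- move/abc_C4r: h.
  have -> : map3 0 1 3 (outer p) = out4 p by case: (p).
  move/C4_abcl => [[u eu hu]|[x [r [ex _ _]]]]; last by move: ex; case: (q).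
  have -> // : outer q = u.
  by move: eu; case: (q) => x; case: (u) => y //= [->].
- move/abc_C4l: h.
  have -> : map3 0 2 3 (outer p) = out4 p by case: (p).
  move/C4_abcr => [[u eu hu]|[x [r [ex _ _]]]]; last by move: ex; case: (q).
  have -> // : outer q = u.
  by move: eu; case: (q) => x; case: (u) => y //= [->].
Qed.

Let edge_trans a p q r :
  p = q \/ edge a p q -> q = r \/ edge a q r -> p = r \/ edge a p r.
Proof.
case=> [->//|h1] [<-|h2]; first by right.
by left; apply: edge_deg (edge_sym h1) h2.
Qed.

Let collapse a d e (f : vertex3 X -> X + X) :
  (forall u v, product_graph d e u v -> f u = f v \/ edge a (f u) (f v)) ->
  forall u v, connected3 d e u v -> f u = f v \/ edge a (f u) (f v).
Proof.
move=> H u v; elim=> [x y /H //|x|x y z _ h1 _ h2]; first by left.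
exact: edge_trans h1 h2.
Qed.

Lemma brauer_mul1l : left_id (@brauer_one X) (@brauer_mul X).
Proof.
move=> a; apply: brauerP => p q; split=> [[n h]|h].
- pose f (u : vertex3 X) : X + X :=
    match u with Up x => inl x | Mid x => inl x | Low x => inr x end.
  have fo r : f (outer r) = r by case: r.
  have := @collapse a (brauer_one X) a f _ _ _ h; rewrite !fo.
  case=> // u v [] [r [s [-> -> hrs]]].
  + by left; case: r s hrs => x [] y //= ->.
  + by right; case: r s hrs => x [] y.
- split; first by move=> e; subst q; apply: edge_irr h.
  have one_conn r : connected3 (brauer_one X) a (outer r) (wedge r).
    case: r => x /=; last exact: rt_refl.
    by apply: rt_step; left; exists (inl x), (inr x).
  apply: rt_trans (one_conn p) _; apply: rt_trans (connected3_sym (one_conn q)).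
  by apply: wedge_conn; right.
Qed.

Lemma brauer_mul1r : right_id (@brauer_one X) (@brauer_mul X).
Proof.
move=> a; apply: brauerP => p q; split=> [[n h]|h].
- pose f (u : vertex3 X) : X + X :=
    match u with Up x => inl x | Mid x => inr x | Low x => inr x end.
  have fo r : f (outer r) = r by case: r.
  have := @collapse a a (brauer_one X) f _ _ _ h; rewrite !fo.
  case=> // u v [] [r [s [-> -> hrs]]].
  + by right; case: r s hrs => x [] y.
  + by left; case: r s hrs => x [] y //= ->.
- split; first by move=> e; subst q; apply: edge_irr h.
  have one_conn r : connected3 a (brauer_one X) (outer r) (vee r).
    case: r => x /=; first exact: rt_refl.
    by apply: rt_step; right; exists (inr x), (inl x).
  apply: rt_trans (one_conn p) _; apply: rt_trans (connected3_sym (one_conn q)).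
  by apply: vee_conn; right.
Qed.

End MonoidLaws.

HB.instance Definition _ (X : Type) := gen_eqMixin (brauer X).
HB.instance Definition _ (X : Type) := gen_choiceMixin (brauer X).
HB.instance Definition _ (X : Type) :=
  isMonoid.Build (brauer X) (@brauer_mulA X) (@brauer_mul1l X) (@brauer_mul1r X).

(* Main.v *)
Require Import Defs.
From Stdlib Require Import Relations.
From mathcomp Require Import all_boot.
From mathcomp Require Import boolp classical_sets functions cardinality.

(** Every element of PB_X is a product [a c b] of one right unit [a] with |X|
    lower hooks, one permutation [c] and one left unit [b] with |X| upper hooks,
    whatever [a] and [b] are; this is [factorisation], the heart of the proof.

    A right unit is an injection of X onto a set of lower vertices, together
    with an arbitrary matching of the other lower vertices ([right_unitP]), and
    dually for left units. In [a c b] the lower row of [a] is glued to the upper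
    row of [b] along a bijection of our choice. A matching is determined up to
    isomorphism by its number of edges and its unmatched vertices
    ([matching_iso]), so instead of a bijection one may choose a common middle
    set M and, on it, any two matchings with |X| edges and with the right
    unmatched vertices ([sandwich]). For M take one ray, a copy of the natural
    numbers, for each vertex of the target [d], each isolated lower vertex of
    [a] and each isolated upper vertex of [b]. If the matchings of [a] and [b]
    alternate along a ray, only one of them matches its origin, which becomes
    the end of an infinite path that goes nowhere else: that is how isolated
    vertices of [d] arise and how the unwanted isolated vertices of [a] and [b]
    are absorbed. If the two matchings skip the origin and agree on the rest of
    the ray, the origin is free to carry an edge of [d].

    Conversely, the elements that are left units if they are right units form a
    subsemigroup, and likewise with left and right exchanged. Both are proper
    since X is infinite, so a set that generates PB_X together with the units
    has an element that is a right unit only and another that is a left unit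
    only. This gives the lower bound on the rank and the first half of the
    condition in (ii). For the hooks, a lower hook of [a b] that is not a
    hook of [b] runs through a lower hook of [a] ([lower_hooks_mul_le]), and an
    infinite cardinal is not the sum of two smaller ones, so that the elements
    with fewer than |X| lower hooks form a subsemigroup. It contains all left
    units, hence not the generator which is a right unit.

    Both directions need a little arithmetic of infinite cardinals, deduced from
    Zorn's lemma. *)

Set Implicit Arguments.
Unset Strict Implicit.
Unset Printing Implicit Defensive.

Local Open Scope classical_set_scope.
Local Open Scope card_scope.

(** * Infinite cardinals *)

Lemma card_le_inj T U (A : set T) (B : set U) (f : T -> U) :
  (forall x, A x -> B (f x)) ->
  (forall x y, A x -> A y -> f x = f y -> x = y) -> A #<= B.
Proof.
move=> fAB finj.
have [|g] := (@injfunPex T U A B).2; last exact: inj_card_le g.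
by exists f => // x y /set_mem Ax /set_mem Ay; apply: finj.
Qed.

Lemma card_le_injP T U (A : set T) (B : set U) :
  B !=set0 -> A #<= B -> exists f : T -> U,
  (forall x, A x -> B (f x)) /\
  (forall x y, A x -> A y -> f x = f y -> x = y).
Proof.
move=> [u0 _] /card_leP[f].
have [g gAB ginj] : exists2 g : T -> U, set_fun A B g & set_inj A g.
  by apply/injfunPex; squash (valLR u0 f).
by exists g; split=> // x y Ax Ay; apply: ginj; rewrite ?inE.
Qed.

(** A maximal partial injection between the two sets is total on one side. *)
Lemma card_le_total T U (A : set T) (B : set U) : A #<= B \/ B #<= A.
Proof.
pose P (R : set (T * U)) := R `<=` A `*` B /\
  forall p q, R p -> R q -> (p.1 = q.1 <-> p.2 = q.2).
have [F FP Ftot|R [[RAB Rinj] Rmax]] := @Zorn_bigcup _ P.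
  split=> [p [R /FP[RAB _]]|p q [R FR Rp] [R' FR' R'q]]; first exact: RAB.
  have [RR'|R'R] := Ftot _ _ FR FR'.
    by apply: (FP _ FR').2 => //; exact: RR'.
  by apply: (FP _ FR).2 => //; exact: R'R.
have [domR|ndomR] := pselect (forall x, A x -> exists y, R (x, y)).
  left; have [->//|/set0P[x0 Ax0]] := eqVneq A set0.
  have [y0 Ry0] := domR _ Ax0.
  have [x|f Rf] := @choice _ _ (fun x y => A x -> R (x, y)).
    by have [/domR[y]|nA] := pselect (A x); [exists y|exists y0].
  apply: (@card_le_inj _ _ _ _ f) => [x /Rf /RAB[]//|x y Ax Ay fxy].
  by apply/(Rinj _ _ (Rf _ Ax) (Rf _ Ay)).
have [ranR|nranR] := pselect (forall y, B y -> exists x, R (x, y)).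
  right; have [->//|/set0P[y0 By0]] := eqVneq B set0.
  have [x0 Rx0] := ranR _ By0.
  have [y|f Rf] := @choice _ _ (fun y x => B y -> R (x, y)).
    by have [/ranR[x]|nB] := pselect (B y); [exists x|exists x0].
  apply: (@card_le_inj _ _ _ _ f) => [y /Rf /RAB[]//|x y Ax Ay fxy].
  by apply/(Rinj _ _ (Rf _ Ax) (Rf _ Ay)).
move/existsNP: ndomR => [x /not_implyP[Ax /forallNP xR]].
move/existsNP: nranR => [y /not_implyP[By /forallNP yR]].
exfalso; apply: (Rmax (R `|` [set (x, y)])).
  split; first by move=> p; left.
  by move=> /(_ (x, y)) => sub; apply: (xR y); apply: sub; right.
split=> [p [/RAB//|->]//|[a b] [c d] /= [Rp|[-> ->]] [Rq|[-> ->]] //].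
- exact: Rinj Rp Rq.
- by split=> e; exfalso; [apply: (xR b)|apply: (yR a)]; rewrite -?e -1?e.
- by split=> e; exfalso; [apply: (xR d)|apply: (yR c)]; rewrite ?e.
Qed.

(** The equation |A| aleph_0 = |A|. A maximal family F of disjoint sequences in A
    covers A up to a finite set, so that |A| = |F| aleph_0. *)
Lemma infinite_mul_nat T (A : set T) : infinite_set A ->
  exists g : T -> nat -> T, (forall x n, A x -> A (g x n)) /\
  (forall x y n m, A x -> A y -> g x n = g y m -> x = y /\ n = m).
Proof.
move=> infA.
pose P (F : set (nat -> T)) :=
  (forall s n, F s -> A (s n)) /\
  (forall s t n m, F s -> F t -> s n = t m -> s = t /\ n = m).
have [C CP Ctot|F [[FA Finj] Fmax]] := @Zorn_bigcup _ P.
  split=> [s n [F CF Fs]|s t n m [F CF Fs] [F' CF' F's]].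
    by apply: (CP _ CF).1.
  have [FF'|F'F] := Ctot _ _ CF CF'.
    by apply: (CP _ CF').2 => //; exact: FF'.
  by apply: (CP _ CF).2 => //; exact: F'F.
pose E := [set x | A x /\ forall s n, F s -> s n <> x].
have addseq D : D `<=` E -> infinite_set D -> False.
  move=> DE /infiniteP; have [->|/set0P D0] := eqVneq D set0.
    by move=> /card_le0P e; have : [set: nat] 0%N by []; rewrite e.
  move=> /(card_le_injP D0)[s [sD sinj]].
  have sE n : E (s n) by apply/DE/sD.
  apply: (Fmax (F `|` [set s])).
    split; first by move=> t; left.
    move=> sub; have Fs : F s by apply: sub; right.
    by have [_ /(_ s 0%N Fs)] := sE 0%N.
  split=> [t n [Ft|->]|t u n m [Ft|->] [Fu|->]].
  - exact: FA.
  - exact: (sE n).1.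
  - exact: Finj.
  - by move=> e; have [_ /(_ t n Ft)] := sE m.
  - by move=> e; have [_ /(_ u m Fu)] := sE n; rewrite e.
  - by move=> /sinj ->.
have finE : finite_set E by apply: contrapT => /(addseq E); exact.
have [s0 Fs0] : exists s, F s.
  apply: contrapT => /forallNP nF; apply: infA.
  apply: sub_finite_set finE => x Ax; split=> // s n Fs.
  by have := nF s.
have [e [_ einj]] : exists e : T -> nat, (forall x, E x -> [set: nat] (e x)) /\
    (forall x y, E x -> E y -> e x = e y -> x = y).
  apply: card_le_injP; first by exists 0%N.
  exact: finite_set_countable.
(* the last component tells apart the points that lie on no sequence *)
pose R x (k : (nat -> T) * (nat * bool)) := F k.1 /\
  if k.2.2 then E x /\ k.2.1 = e x else k.1 k.2.1 = x.
have [x|c cR] := @choice _ _ (fun x k => A x -> R x k).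
  have [Ax|nA] := pselect (A x); last by exists (s0, (0%N, true)).
  have [[s [n [Fs sn]]]|ns] := pselect (exists s n, F s /\ s n = x).
    by exists (s, (n, false)).
  exists (s0, (e x, true)) => _; split=> //=; split=> //; split=> // s n Fs sn.
  by apply: ns; exists s, n.
exists (fun x n => (c x).1 (pickle ((c x).2, n))); split=> [x n /cR[Fc _]|].
  exact: FA.
move=> x y n m /cR[Fx Rx] /cR[Fy Ry] /(Finj _ _ _ _ Fx Fy).
move=> [e1 /(pcan_inj pickleK)] [e2 ->]; split=> //.
move: Rx Ry; rewrite e1 e2; case: ifP => _; last by move=> -> ->.
by move=> [Ex ->] [Ey /einj ->].
Qed.

Lemma card_le_setU_infinite T U (A : set T) (B C : set U) :
  infinite_set A -> A #<= B `|` C -> A #<= B \/ A #<= C.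
Proof.
move=> infA; wlog BC : B C / B #<= C => [wl|].
  have [BC|CB] := card_le_total B C; first exact: wl.
  by rewrite setUC => /(wl _ _ CB) [|]; [right|left].
move=> ABC; right; apply: card_le_trans (ABC) _.
have infC : infinite_set C.
  move=> finC; apply: infA; apply: card_le_finite ABC _.
  by rewrite finite_setU; split=> //; apply: card_le_finite BC _.
have [g [gC ginj]] := infinite_mul_nat infC.
have [f [fC finj]] := card_le_injP (infinite_setN0 infC) BC.
pose h x := if pselect (C x) then g x 0%N else g (f x) 1%N.
apply: (@card_le_inj _ _ _ _ h).
  by move=> x; rewrite /h; case: pselect => //= [Cx _|nC [/fC|]//]; apply: gC.
move=> x y; rewrite /h; case: pselect => [Cx|nCx]; case: pselect => [Cy|nCy] //=;
  by move=> [] // Bx [] // By /ginj [] //; auto.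
Qed.

(** * Products, duality and one-sided units *)

Section Products.
Variable X : Type.
Implicit Types (a b c : brauer X) (p q : X + X) (u v : vertex3 X).

Lemma connected3_closed a b (C : vertex3 X -> Prop) u v :
  (forall w w', product_graph a b w w' -> C w -> C w') ->
  connected3 a b u v -> C u -> C v.
Proof. by move=> CC; elim=> [w w' /CC||w1 w2 w3 _ IH1 _ IH2 /IH1/IH2]. Qed.

Lemma connected3_vee a b p q : edge a p q -> connected3 a b (vee p) (vee q).
Proof. by move=> h; apply: rt_step; left; exists p, q. Qed.

Lemma connected3_wedge a b p q : edge b p q -> connected3 a b (wedge p) (wedge q).
Proof. by move=> h; apply: rt_step; right; exists p, q. Qed.

(** A certificate for a product: a label that is constant along the edges of
    the product graph separates its components, so only the edges of [c] are
    left to be joined by paths. *)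
Lemma mul_eq_of_label a b c T (l : vertex3 X -> T) :
  (forall p q, edge a p q -> l (vee p) = l (vee q)) ->
  (forall p q, edge b p q -> l (wedge p) = l (wedge q)) ->
  (forall p q, l (outer p) = l (outer q) -> p = q \/ edge c p q) ->
  (forall p q, edge c p q -> connected3 a b (outer p) (outer q)) ->
  (a * b)%g = c.
Proof.
move=> la lb lc cc; apply: brauerP => p q; split=> [[npq pq]|pq].
  have [||//] := lc p q _; [|by move=> e; case: npq].
  symmetry; pose C w := l w = l (outer p).
  apply: (@connected3_closed a b C _ _ _ pq) => // w w'; rewrite /C.
  by move=> [] [r [s [-> -> +]]] => [/la|/lb] ->.
by split; [move=> e; subst q; apply: edge_irr pq|apply: cc].
Qed.

Definition vflip p := match p with inl x => inr x | inr x => inl x end.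

Lemma vflipK : involutive vflip. Proof. by case. Qed.

(** The anti-involution that turns a graph upside down; it exchanges left and
    right units, and upper and lower hooks. *)
Definition star a : brauer X.
Proof.
exists (fun p q => edge a (vflip p) (vflip q)).
- by move=> p q; apply: edge_sym.
- by move=> p; apply: edge_irr.
- by move=> p q r pq /(edge_deg pq) /(can_inj vflipK).
Defined.

Lemma starK : involutive star.
Proof. by move=> a; apply: brauerP => p q /=; rewrite !vflipK. Qed.

Lemma star1 : star 1%g = 1%g.
Proof. by apply: brauerP => -[x|x] [y|y] /=; split=> // ->. Qed.

Lemma starM a b : star (a * b)%g = (star b * star a)%g.
Proof.
pose f u := match u with Up x => Low x | Mid x => Mid x | Low x => Up x end.
have fo p : f (outer p) = outer (vflip p) by case: p.
have flip c d u v : connected3 c d u v -> connected3 (star d) (star c) (f u) (f v).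
  elim=> [{}u {}v|w|w1 w2 w3 _ h1 _ h2]; [|exact: rt_refl|exact: rt_trans h1 h2].
  case=> -[p [q [-> -> pq]]]; apply: rt_step; [right|left];
    by exists (vflip p), (vflip q); rewrite /= !vflipK; split=> //;
      [case: (p)|case: (q)].
apply: brauerP => p q; split=> -[npq /flip].
  by rewrite !fo !vflipK => h; split=> // e; apply: npq; rewrite e.
by rewrite !fo !starK => h; split=> // /(can_inj vflipK).
Qed.

Lemma left_units_star a : left_units (brauer X) a <-> right_units (brauer X) (star a).
Proof.
split=> -[b e]; exists (star b); first by rewrite -starM e star1.
by apply: (can_inj starK); rewrite starM starK e star1.
Qed.

(** An upper hook of [a] remains a hook in every product [a * b], and an isolated
    upper vertex remains isolated; without either, [star a] is a right inverse. *)
Lemma right_unitP a :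
  right_units (brauer X) a <-> forall x, exists y, edge a (inl x) (inr y).
Proof.
split=> [[b ab1] x|tr].
  apply: contrapT => /forallNP nx.
  have [_ xx] : edge (a * b)%g (inl x) (inr x) by rewrite ab1.
  pose C u := u = Up x \/ exists2 y, u = Up y & edge a (inl x) (inl y).
  have : C (Low x); last by case=> // -[].
  apply: (@connected3_closed _ _ C _ _ _ xx); last by left.
  move=> w w' [] [p [q [-> -> pq]]] [ew|[y ew xy]].
  - case: p ew pq => // _ [->]; case: q => [y|y] h; last by have := nx y.
    by right; exists y.
  - case: p ew pq => // _ [->] /(edge_deg (edge_sym xy)) <-; by left.
  - by case: p ew {pq}.
  - by case: p ew {pq}.
exists (star a).
pose l u := match u with
  | Up x | Low x => [set x]
  | Mid y => [set x | edge a (inl x) (inr y)] end.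
have la p q : edge a p q -> l (vee p) = l (vee q).
  have h x y : edge a (inl x) (inr y) -> l (Up x) = l (Mid y).
    move=> xy; apply/seteqP; split=> [_ -> //|z /= zy].
    by case: (edge_deg (edge_sym xy) (edge_sym zy)).
  case: p q => [x|x] [y|y] pq /=; [|exact: h|exact/esym/h/edge_sym|].
    by have [z /(edge_deg pq)] := tr x.
  apply/seteqP; split=> z /= zx.
    by have := edge_deg pq (edge_sym zx).
  by have := edge_deg (edge_sym pq) (edge_sym zx).
apply: (@mul_eq_of_label _ _ _ _ l) => //.
- by move=> p q /la; case: p; case: q.
- move=> [x|x] [y|y] /=; rewrite eqEsubset => -[/(_ x erefl) /= -> _];
    by [left|right].
have conn x : connected3 a (star a) (Up x) (Low x).
  have [y xy] := tr x; apply: (@rt_trans _ _ _ (Mid y)).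
    exact: (connected3_vee (star a) xy).
  exact: (connected3_wedge a (b := star a) (p := inl y) (q := inr x) (edge_sym xy)).
by move=> [x|x] [y|y] //= ->; [|apply: connected3_sym].
Qed.

Lemma left_unitP a :
  left_units (brauer X) a <-> forall y, exists x, edge a (inl x) (inr y).
Proof.
rewrite left_units_star right_unitP; split=> h x; have [y xy] := h x;
  by exists y; apply: edge_sym.
Qed.

Lemma lower_hooks_star a : lower_hooks (star a) = upper_hooks a.
Proof. by []. Qed.

Lemma lower_hooks_left_unit a : left_units (brauer X) a -> lower_hooks a = set0.
Proof.
move/left_unitP => tr; apply/seteqP; split=> // e [x [y [xy _]]].
by have [z /edge_sym /(edge_deg xy)] := tr x.
Qed.

(** The path in the product graph that yields a lower hook of [a * b] starts at
    a lower vertex [y]. If it is not an edge of [b], it reaches a middle vertex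
    [m] and continues through a lower hook of [a] at [m], since otherwise the
    component ends there or in the upper row. Distinct components use distinct
    hooks of [a]. *)
Lemma lower_hooks_mul_le a b :
  lower_hooks (a * b)%g `\` lower_hooks b #<= lower_hooks a.
Proof.
pose comp y := [set w | connected3 a b (Low y) (Low w)].
pose R (e g : set X) := exists y m m', [/\ e = comp y, g = [set m; m'],
  edge a (inr m) (inr m') & edge b (inr y) (inl m)].
have [e|f fR] := @choice _ _ (fun e g =>
    (lower_hooks (a * b)%g `\` lower_hooks b) e -> R e g).
  have [[[y [z [yz ->]]] neb]|] :=
    pselect ((lower_hooks (a * b)%g `\` lower_hooks b) e);
    last by exists set0.
  have [[m [m' [ym mm']]]|nm] :=
      pselect (exists m m', edge b (inr y) (inl m) /\ edge a (inr m) (inr m')).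
    exists [set m; m'] => _; exists y, m, m'; split=> //.
    apply/seteqP; split=> [w [->|->]|w yw]; [exact: rt_refl|exact: yz.2|].
    have [[->]|yw'] := (connected3_outer a b (inr y) (inr w)).1 yw; first by left.
    by have [->] := edge_deg yz yw'; right.
  (* without such a hook, the component of [y] is too small to reach [z] *)
  exfalso; pose C u := match u with
    | Up x => exists m, edge b (inr y) (inl m) /\ edge a (inr m) (inl x)
    | Mid m => edge b (inr y) (inl m)
    | Low w => w = y \/ edge b (inr y) (inr w) end.
  have : C (Low z).
    apply: (@connected3_closed _ _ C _ _ _ yz.2); last by left.
    move=> w w' [] [[r|r] [[s|s] [-> -> rs]]] /=.
    - by move=> [m [ym /edge_sym mr]]; have := edge_deg rs mr.
    - by move=> [m [ym mr]]; have [->] := edge_deg rs (edge_sym mr).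
    - by move=> yr; exists r.
    - by move=> yr; exfalso; apply: nm; exists r, s.
    - by move=> yr; have := edge_deg rs (edge_sym yr).
    - by move=> yr; have [->] := edge_deg rs (edge_sym yr); left.
    - by case=> [<-//|yr]; have := edge_deg rs (edge_sym yr).
    - by case=> [<-|yr]; [right|have [->] := edge_deg rs (edge_sym yr); left].
  case=> [zy|zy]; first by case: yz => /(_ (congr1 inr (esym zy))).
  by apply: neb; exists y, z.
apply: (@card_le_inj _ _ _ _ f) => [e /fR[y [m [m' [_ -> mm' _]]]]|].
  by exists m, m'.
move=> e e' /fR[y [m [m' [-> fe mm' ym]]]] /fR[z [n [n' [-> fe' _ zn]]]] ff.
have yz : connected3 a b (Low y) (Low z).
  apply: (@rt_trans _ _ _ (Mid m)); first exact: (connected3_wedge a ym).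
  apply: (@rt_trans _ _ _ (Mid n)); last first.
    exact: (connected3_wedge a (edge_sym zn)).
  have : [set m; m'] n by rewrite -fe ff fe'; left.
  by case=> ->; [exact: rt_refl|exact: (connected3_vee b mm')].
apply/seteqP; split=> w /= cw; apply: rt_trans cw => //.
exact: connected3_sym.
Qed.

Lemma infinite_lower_hooks_mul a b : infinite_set [set: X] ->
  [set: X] #<= lower_hooks (a * b)%g ->
  [set: X] #<= lower_hooks a \/ [set: X] #<= lower_hooks b.
Proof.
move=> infX le; have [|le'|le'] := card_le_setU_infinite infX
  (B := lower_hooks (a * b)%g `\` lower_hooks b) (C := lower_hooks b).
- apply: card_le_trans le _; apply: subset_card_le => e abe.
  by have [|] := pselect (lower_hooks b e); [right|left].
- by left; apply: card_le_trans le' (lower_hooks_mul_le a b).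
- by right.
Qed.

End Products.

(** * Isomorphism of matchings *)

Definition matching M (R : M -> M -> Prop) :=
  [/\ forall m n, R m n -> R n m, forall m, ~ R m m &
      forall m n n', R m n -> R m n' -> n = n'].

Definition hooks M (R : M -> M -> Prop) : set (set M) :=
  [set e | exists m n, R m n /\ e = [set m; n]].

Definition enumerates_unmatched M U (R : M -> M -> Prop) (J : U -> M) :=
  injective J /\ forall m, (exists u, J u = m) <-> forall n, ~ R m n.

Lemma enumerates_unmatchedN M U (R : M -> M -> Prop) (J : U -> M) u n :
  enumerates_unmatched R J -> ~ R (J u) n.
Proof. by move=> [_ Junm]; apply: (Junm (J u)).1; exists u. Qed.

Lemma inj_surj_can A B (f : A -> B) : injective f -> (forall y, exists x, f x = y) ->
  exists2 g, cancel f g & cancel g f.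
Proof.
move=> finj /choice[g fg]; exists g => // x; exact: finj.
Qed.

(** Choosing an orientation of each edge identifies the vertices of a matching
    with the unmatched ones plus two for each edge. *)
Lemma matching_param M U K (R : M -> M -> Prop) (J : U -> M) (e : K -> set M) :
  matching R -> enumerates_unmatched R J ->
  injective e -> (forall k, hooks R (e k)) ->
  (forall E, hooks R E -> exists k, e k = E) ->
  exists (f : U + K * bool -> M) (g : M -> U + K * bool),
  [/\ cancel f g, cancel g f, forall u, f (inl u) = J u &
      forall k b, R (f (inr (k, b))) (f (inr (k, ~~ b)))].
Proof.
move=> [Rsym Rirr Rdeg] JR einj eR esurj.
have [k|c cR] := @choice _ _ (fun k (c : M * M) => R c.1 c.2 /\ e k = [set c.1; c.2]).
  by have [m [n mn]] := eR k; exists (m, n).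
pose f i := match i with inl u => J u
  | inr (k, b) => if b then (c k).1 else (c k).2 end.
have fR k b : R (f (inr (k, b))) (f (inr (k, ~~ b))).
  by have [Rk _] := cR k; case: b => //=; apply: Rsym.
have fe k b : e k = [set f (inr (k, b)); f (inr (k, ~~ b))].
  by have [_ ->] := cR k; case: b => //=; rewrite setUC.
have Jf u k b : J u <> f (inr (k, b)).
  by move=> Jf; have := fR k b; rewrite -Jf; apply: enumerates_unmatchedN JR.
have [|m|g fg gf] := @inj_surj_can _ _ f.
- move=> [u|[k b]] [u'|[k' b']].
  + by move=> /JR.1 ->.
  + by move=> /Jf.
  + by move=> /esym/Jf.
  + move=> ff; have kk : k = k'.
      apply: einj; rewrite (fe k b) (fe k' b') ff; congr [set _; _].
      by apply: (Rdeg _ _ _ (fR k b)); rewrite ff; exact: fR.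
    subst k'; have [->//|/negPf bb] := eqVneq b b'.
    have {}bb : b' = ~~ b by case: (b) (b') bb => [] [].
    by have := fR k b; rewrite ff bb => /Rirr.
- have [[n mn]|nm] := pselect (exists n, R m n); last first.
    have [|u <-] := (JR.2 m).2; last by exists (inl u).
    by move=> n mn; apply: nm; exists n.
  have [|k ek] := esurj [set m; n]; first by exists m, n.
  have : [set f (inr (k, true)); f (inr (k, false))] m.
    by rewrite -(fe k true) ek; left.
  by case=> ->; eexists.
by exists f, g.
Qed.

(** Matchings are classified by their unmatched vertices and their number of
    edges. *)
Lemma matching_iso M M' U (R : M -> M -> Prop) (R' : M' -> M' -> Prop)
    (J : U -> M) (J' : U -> M') :
  matching R -> matching R' ->
  enumerates_unmatched R J -> enumerates_unmatched R' J' ->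
  hooks R #= hooks R' ->
  exists (f : M -> M') (g : M' -> M),
  [/\ cancel f g, cancel g f, forall u, f (J u) = J' u &
      forall m n, R' (f m) (f n) <-> R m n].
Proof.
move=> mR mR' JR JR' /card_bijP[h [h' hK h'K]].
have [||E HE|f [g [fK gK fJ fR]]] :=
  @matching_param M U (hooks R) R J (fun k => set_val k) mR JR.
- exact: val_inj.
- by move=> k; apply/set_mem/(valP k).
- by exists (SigSub (mem_set HE)).
have [||E HE|f' [g' [fK' gK' fJ' fR']]] :=
  @matching_param M' U (hooks R) R' J' (fun k => set_val (h k)) mR' JR'.
- by move=> k k' /val_inj /(can_inj hK).
- by move=> k; apply/set_mem/(valP (h k)).
- by exists (h' (SigSub (mem_set HE))); rewrite h'K.
exists (f' \o g), (f \o g'); split=> [||u|m n] /=.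
- by move=> m /=; rewrite fK' gK.
- by move=> m /=; rewrite fK gK'.
- by rewrite -fJ fK fJ'.
rewrite -{2}(gK m) -{2}(gK n).
case: (g m) (g n) => [u|[k b]] j.
  rewrite fJ' fJ; split; [move=> /(enumerates_unmatchedN JR')|
    move=> /(enumerates_unmatchedN JR)]; by [].
case: mR mR' => _ _ Rdeg [_ _ Rdeg'].
split=> [/(Rdeg' _ _ _ (fR' k b)) /(can_inj fK') <-|]; first exact: fR.
by move=> /(Rdeg _ _ _ (fR k b)) /(can_inj fK) <-.
Qed.

(** * Products of a right unit, a permutation and a left unit *)

Section Permutations.
Variable X : Type.
Implicit Types (a b c d : brauer X) (p q : X + X).

Definition perm_edge (f : X -> X) p q :=
  match p, q with
  | inl x, inr y | inr y, inl x => f x = y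
  | _, _ => False
  end.

Definition perm_brauer (f g : X -> X) (fK : cancel f g) : brauer X.
Proof.
exists (perm_edge f) => [[x|x] [y|y]|[x|x]|[x|x] [y|y] [z|z]] //=.
- by move=> -> ->.
- by move=> <- /(can_inj fK) ->.
Defined.

Lemma perm_unit (f g : X -> X) (fK : cancel f g) (gK : cancel g f) :
  units (brauer X) (perm_brauer fK).
Proof.
split; first by apply/left_unitP => y; exists (g y) => /=.
by apply/right_unitP => x; exists (f x).
Qed.

(** The component of [p] in the graph [a]; it serves as a label of vertices that
    recovers the edges of [a]. *)
Definition class a p : set (X + X) := [set q | p = q \/ edge a p q].

Lemma class_edge a p q : edge a p q -> class a p = class a q.
Proof.
have sub r s : edge a r s -> class a r `<=` class a s.
  move=> rs t [<-|rt]; first by right; apply: edge_sym.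
  by left; apply: edge_deg rs rt.
by move=> pq; apply/seteqP; split; apply: sub => //; apply: edge_sym.
Qed.

Lemma class_eq a p q : class a p = class a q -> p = q \/ edge a p q.
Proof. by move=> pq; have : class a p q by rewrite pq; left. Qed.

Definition relabel_vertex (g : X -> X) p : X + X :=
  match p with inl x => inl x | inr y => inr (g y) end.

Lemma relabel_vertex_inj (g : X -> X) : injective g -> injective (relabel_vertex g).
Proof. by move=> ginj [x|x] [y|y] //= [] /ginj ->. Qed.

Definition relabel a (g : X -> X) (ginj : injective g) : brauer X.
Proof.
exists (fun p q => edge a (relabel_vertex g p) (relabel_vertex g q)).
- by move=> p q; apply: edge_sym.
- by move=> p; apply: edge_irr.
- by move=> p q s pq /(edge_deg pq) /(relabel_vertex_inj ginj).
Defined.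

(** Multiplication by a permutation renames the lower vertices. *)
Lemma mul_perm a (f g : X -> X) (fK : cancel f g) (gK : cancel g f) :
  (a * perm_brauer fK)%g = relabel a (can_inj gK).
Proof.
pose l u := match u with Up x => class a (inl x) | Mid y => class a (inr y)
  | Low z => class a (inr (g z)) end.
apply: (@mul_eq_of_label _ _ _ _ _ l).
- by move=> [x|x] [y|y] /class_edge.
- by move=> [x|x] [y|y] //= <-; rewrite fK.
- move=> p q e; have [|/(relabel_vertex_inj (can_inj gK))|] :=
    @class_eq a (relabel_vertex g p) (relabel_vertex g q); [|by left|by right].
  by case: p q e => [x|x] [y|y].
have conn p : connected3 a (perm_brauer fK) (outer p) (vee (relabel_vertex g p)).
  case: p => x /=; first exact: rt_refl.
  exact: (connected3_wedge a (b := perm_brauer fK)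
    (p := inr x) (q := inl (g x)) (gK x)).
move=> p q /= pq; apply: rt_trans (conn p) _.
apply: rt_trans (connected3_sym (conn q)).
exact: (connected3_vee _ pq).
Qed.

(** The lower row of the right unit [a] can be identified with [M] so that the
    upper vertex [x] is joined to [F x], and [R] is the matching by lower hooks. *)
Definition models a M (F : X -> M) (R : M -> M -> Prop) :=
  exists (f : M -> X) (g : X -> M), [/\ cancel f g, cancel g f,
    forall x, edge a (inl x) (inr (f (F x))) &
    forall m n, edge a (inr (f m)) (inr (f n)) <-> R m n].

(** The identifications of the lower row of [a] and of the upper row of [b] with
    [M] differ by a permutation [c], so that the middle row of the product graph
    of [a * c] and [b] becomes [M], with [R] and [S] as its edges. The label [l]
    proves that [a * c * b] has no other edges than [d]. *)
Lemma sandwich a b d M (F G : X -> M) (R S : M -> M -> Prop) (l : M -> set (X + X)) :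
  models a F R -> models (star b) G S ->
  (forall x, l (F x) = class d (inl x)) -> (forall y, l (G y) = class d (inr y)) ->
  (forall m n, R m n \/ S m n -> l m = l n) ->
  (forall x y, edge d (inl x) (inr y) -> F x = G y) ->
  (forall x y, edge d (inl x) (inl y) -> S (F x) (F y)) ->
  (forall x y, edge d (inr x) (inr y) -> R (G x) (G y)) ->
  exists2 c, units (brauer X) c & (a * c * b)%g = d.
Proof.
move=> [f [g [fK gK aF aR]]] [f' [g' [fK' gK' bG bS]]] lF lG lRS dt du dl.
have cK : cancel (f' \o g) (f \o g') by move=> x /=; rewrite fK' gK.
have c'K : cancel (f \o g') (f' \o g) by move=> x /=; rewrite fK gK'.
exists (perm_brauer cK); first exact: perm_unit c'K.
rewrite (mul_perm a cK c'K); set a' := relabel _ _.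
have a'F x : edge a' (inl x) (inr (f' (F x))) by rewrite /= fK'.
have a'R m n : edge a' (inr (f' m)) (inr (f' n)) <-> R m n by rewrite /= !fK'.
have b'G y : edge b (inr y) (inl (f' (G y))) := bG y.
have b'S m n : edge b (inl (f' m)) (inl (f' n)) <-> S m n := bS m n.
pose L u := match u with Up x => class d (inl x) | Mid z => l (g' z)
  | Low y => class d (inr y) end.
have La p q : edge a' p q -> L (vee p) = L (vee q).
  have h x z : edge a' (inl x) (inr z) -> L (Up x) = L (Mid z).
    by move=> /(edge_deg (a'F x)) [<-] /=; rewrite fK'.
  case: p q => [x|x] [y|y]; [|exact: h|by move/edge_sym/h|].
    by move/(edge_deg (a'F x)).
  by rewrite -(gK' x) -(gK' y) => /a'R xy /=; rewrite !fK'; apply: lRS; left.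
have Lb p q : edge b p q -> L (wedge p) = L (wedge q).
  have h x z : edge b (inr x) (inl z) -> L (Low x) = L (Mid z).
    by move=> /(edge_deg (b'G x)) [<-] /=; rewrite fK'.
  case: p q => [x|x] [y|y]; [|by move/edge_sym/h|exact: h|].
    by rewrite -(gK' x) -(gK' y) => /b'S xy /=; rewrite !fK'; apply: lRS; right.
  by move/(edge_deg (b'G x)).
apply: (@mul_eq_of_label _ _ _ _ _ L) => //.
  by move=> p q e; apply: (@class_eq d); move: e; case: p; case: q.
have cF x : connected3 a' b (Up x) (Mid (f' (F x))).
  exact: (connected3_vee b (a'F x)).
have cG y : connected3 a' b (Low y) (Mid (f' (G y))).
  exact: (connected3_wedge a' (b'G y)).
move=> [x|x] [y|y] xy /=.
- apply: rt_trans (cF x) _; apply: rt_trans (connected3_sym (cF y)).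
  by apply: (connected3_wedge a' (p := inl _) (q := inl _)); exact/b'S/du.
- by apply: rt_trans (cF x) _; rewrite (dt _ _ xy); exact: connected3_sym.
- apply: rt_trans (cG x) _; rewrite -(dt _ _ (edge_sym xy)).
  exact: connected3_sym.
- apply: rt_trans (cG x) _; apply: rt_trans (connected3_sym (cG y)).
  by apply: (connected3_vee b (p := inr _) (q := inr _)); exact/a'R/dl.
Qed.

(** For a right unit, these and the upper vertices index the lower vertices that
    are not in a hook. *)
Definition free_lower a : Type := {y : X | forall p, ~ edge a (inr y) p}.

Lemma free_lower_inj a (s t : free_lower a) : sval s = sval t -> s = t.
Proof. by case: s t => [y ny] [z nz] /= yz; apply: eq_exist. Qed.

Lemma right_unit_models a M (J : X + free_lower a -> M) (R : M -> M -> Prop) :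
  right_units (brauer X) a -> matching R -> enumerates_unmatched R J ->
  hooks R #= lower_hooks a -> models a (fun x => J (inl x)) R.
Proof.
move=> /right_unitP /choice[t at_] mR JR RX.
pose Ra y z := edge a (inr y) (inr z).
pose Ja (i : X + free_lower a) := match i with inl x => t x | inr s => sval s end.
have mRa : matching Ra.
  split=> [m n|m|m n n'].
  - exact: edge_sym.
  - exact: edge_irr.
  - by move=> mn /(edge_deg mn) [].
have JRa : enumerates_unmatched Ra Ja.
  split=> [[x|[x nx]] [y|[y ny]] /= e|y].
  - by have := at_ x; rewrite e => /edge_sym /(edge_deg (edge_sym (at_ y))) [->].
  - by case: (ny (inl x)); rewrite -e; apply: edge_sym.
  - by case: (nx (inl y)); rewrite e; apply: edge_sym.
  - by congr inr; apply: free_lower_inj.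
  split=> [[[x|[x nx]] <-] n /=|ny].
  - by move=> /(edge_deg (edge_sym (at_ x))).
  - exact: nx.
  have [[x xy]|nx] := pselect (exists x, edge a (inr y) (inl x)).
    by exists (inl x); have [] := edge_deg (at_ x) (edge_sym xy).
  suff fy : forall p, ~ edge a (inr y) p by exists (inr (exist _ y fy)).
  by move=> [x|z] h; [apply: nx; exists x|apply: ny h].
have [f [g [fK gK fJ fR]]] := matching_iso mR mRa JR JRa RX.
by exists f, g; split=> // x; rewrite fJ.
Qed.

End Permutations.

(** * The factorisation *)

Section Rays.
Variables (V : Type) (k : V -> bool) (h : V -> V -> Prop).
Hypotheses (mh : matching h) (hk : forall v w, h v w -> k v).

(** On [V * nat], thought of as a family of rays with origins [(v, 0)], the
    hooks on the ray of [v] are {1,2}, {3,4}, ... if [k v] holds, which leaves the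
    origin free, and {0,1}, {2,3}, ... otherwise; free origins may be linked by
    the matching [h]. *)
Definition rays (m n : V * nat) : Prop :=
  [\/ [/\ m.1 = n.1, odd m.2 = k m.1 & n.2 = m.2.+1],
      [/\ m.1 = n.1, odd n.2 = k n.1 & m.2 = n.2.+1] |
      [/\ m.2 = 0, n.2 = 0 & h m.1 n.1]].

Lemma rays_matching : matching rays.
Proof.
case: mh => hsym hirr hdeg; split.
- move=> m n [[e o s]|[e o s]|[mO nO mn]].
  + by constructor 2.
  + by constructor 1.
  + by constructor 3; split=> //; apply: hsym.
- move=> [v n] [[_ _ /= /esym]|[_ _ /= /esym]|[_ _ /hirr //]];
    by move/eqP; rewrite eqn_leq ltnn.
- move=> [v n] [w m] [w' m'] [] [/= e1 e2 e3] [] [/= f1 f2 f3]; subst=> //.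
  + by move: f2; rewrite -e2 /=; case: (odd m').
  + by move: (hk f3) e2 => ->.
  + by move: e2; rewrite -f2 /=; case: (odd m).
  + by case: f3 => ->.
  + by move: (hk e3) f2 => ->.
  + by rewrite (hdeg _ _ _ e3 f3).
Qed.

Lemma rays_unmatched m : (forall n, ~ rays m n) <->
  [/\ m.2 = 0, k m.1 & forall w, ~ h m.1 w].
Proof.
case: m => v n; split=> [free|[/= -> kv nh] [w m] [[/= _]|[//]|[_ _ /nh//]]];
  last by rewrite kv.
have nh w : n = 0 -> ~ h v w by move=> n0 hw; apply: (free (w, 0)); constructor 3.
case: n free nh => [|n] free nh.
  split=> //=; last by move=> w; apply: nh.
  by apply/negPn/negP => /negPf kv; apply: (free (v, 1)); constructor 1.
exfalso; have [e|ne] := eqVneq (odd n) (k v).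
  by apply: (free (v, n)); constructor 2.
apply: (free (v, n.+2)); constructor 1; split=> //=.
by case: (odd n) (k v) ne => [] [].
Qed.

(** Each ray contains a hook; its first one starts at 0 or 1 according to
    [k v], seen as a number. *)
Lemma hooks_rays_ge : [set: V] #<= hooks rays.
Proof.
pose e v := [set (v, k v : nat); (v, (k v).+1)].
apply: (@card_le_inj _ _ _ _ e) => [v _|v w _ _ vw].
  exists (v, k v : nat), (v, (k v).+1); split=> //; constructor 1; split=> //=.
  by case: (k v).
have : e w (v, k v : nat) by rewrite -vw; left.
by case=> -[].
Qed.

End Rays.

Lemma hooks_le M (R : M -> M -> Prop) : matching R -> hooks R #<= [set: M].
Proof.
move=> [Rsym _ Rdeg]; have [->|/set0P[e0 [m0 _]]] := eqVneq (hooks R) set0.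
  exact: card_ge0.
have [e|f fR] := @choice _ _ (fun e m =>
    hooks R e -> exists2 n, R m n & e = [set m; n]).
  have [[m [n [mn ->]]]|] := pselect (hooks R e); last by exists m0.
  by exists m => _; exists n.
apply: (@card_le_inj _ _ _ _ f) => // e e' /fR[n en ee] /fR[n' en' ee'] ff.
by rewrite ff in en ee; rewrite ee (Rdeg _ _ _ en en').
Qed.

Section Factorisation.
Variable X : Type.
Hypothesis infX : infinite_set [set: X].
Variables (a b d : brauer X).

Let origins : Type := (X + X) + (free_lower a + free_lower (star b)).

Lemma origins_nat_le : [set: origins * nat] #<= [set: X].
Proof.
have [g [_ ginj]] := infinite_mul_nat infX.
pose c (v : origins) : X * nat := match v with
  | inl (inl x) => (x, 0) | inl (inr x) => (x, 1)
  | inr (inl s) => (sval s, 2) | inr (inr s) => (sval s, 3) end.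
have cinj : injective c.
  move=> [[x|x]|[s|s]] [[y|y]|[t|t]] //= [] e; rewrite ?e //.
    by have -> := free_lower_inj e.
  by have -> := @free_lower_inj _ (star b) _ _ e.
apply: (@card_le_inj _ _ _ _ (fun m => g (c m.1).1 (pickle ((c m.1).2, m.2)))) => //.
move=> [v n] [w m] _ _ /= /ginj [] // e1 /(pcan_inj pickleK) [e2 ->].
congr pair; apply: cinj.
by rewrite (surjective_pairing (c v)) e1 e2 -surjective_pairing.
Qed.

Lemma hooks_rays_card (k : origins -> bool) h :
  matching h -> (forall v w, h v w -> k v) -> hooks (rays k h) #= [set: X].
Proof.
move=> mh hk; rewrite card_eq_le; apply/andP; split.
  apply: card_le_trans origins_nat_le.
  exact: (hooks_le (rays_matching mh hk)).
apply: card_le_trans (hooks_rays_ge k h).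
by apply: (@card_le_inj _ _ _ _ (fun x => inl (inl x))) => // x y _ _ [].
Qed.

(** The matching of [a] on the middle row. The origin [inl (inl x)] is the end of
    the edge of [a] from the upper vertex [x], and [inr (inl s)] is an isolated
    lower vertex of [a], so these must stay unmatched. The origins [inl (inr y)],
    with [y] in the lower row of [d], must be matched; they are linked if [y]
    belongs to a lower hook of [d]. *)
Definition a_skip (v : origins) : bool := match v with
  | inl (inl _) => true
  | inl (inr y) => `[< exists z, edge d (inr y) (inr z) >]
  | inr (inl _) => true
  | inr (inr _) => false end.

(** The matching of [b], dual to that of [a] except for the transversals {x, y'}
    of [d]: the origins of [x] and [y'] cannot both represent that edge, and
    [b] takes the one of [x], on whose ray it skips the origin as [a] does. The
    ray of [y'] then splits into pairs that are hooks of both [a] and [b]. *)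
Definition b_skip (v : origins) : bool := match v with
  | inl (inl x) => `[< exists p, edge d (inl x) p >]
  | inl (inr y) => `[< forall x, ~ edge d (inr y) (inl x) >]
  | inr (inl _) => false
  | inr (inr _) => true end.

Definition a_link (v w : origins) : Prop :=
  match v, w with
  | inl (inr y), inl (inr z) => edge d (inr y) (inr z)
  | _, _ => False end.

Definition b_link (v w : origins) : Prop :=
  match v, w with
  | inl (inl x), inl (inl z) => edge d (inl x) (inl z)
  | _, _ => False end.

Lemma a_link_matching : matching a_link.
Proof.
split=> [[[x|x]|v] [[y|y]|w]|[[x|x]|v]|[[x|x]|v] [[y|y]|w] [[z|z]|u]] //=.
- exact: edge_sym.
- exact: edge_irr.
- by move=> xy /(edge_deg xy) [->].
Qed.

Lemma b_link_matching : matching b_link.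
Proof.
split=> [[[x|x]|v] [[y|y]|w]|[[x|x]|v]|[[x|x]|v] [[y|y]|w] [[z|z]|u]] //=.
- exact: edge_sym.
- exact: edge_irr.
- by move=> xy /(edge_deg xy) [->].
Qed.

Lemma a_link_skip v w : a_link v w -> a_skip v.
Proof. by case: v w => [[x|x]|v] [[y|y]|w] //= xy; apply/asboolP; exists y. Qed.

Lemma b_link_skip v w : b_link v w -> b_skip v.
Proof. by case: v w => [[x|x]|v] [[y|y]|w] //= xy; apply/asboolP; exists (inl y). Qed.

(** A vertex of [d] that is isolated, or a free vertex of [a] or [b], is the
    origin of a ray along which hooks of [a] and [b] alternate forever; the other
    rays, apart from their origins, consist of cycles of length two. *)
Lemma factorisation :
  right_units (brauer X) a -> left_units (brauer X) b ->
  lower_hooks a #= [set: X] -> upper_hooks b #= [set: X] ->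
  exists2 c, units (brauer X) c & (a * c * b)%g = d.
Proof.
move=> ra lb ha hb.
(* [(inl (s y), 0)] is the middle vertex joined to the lower vertex [y] by [b] *)
have [y|s sP] := @choice _ _ (fun y p => edge d (inr y) p /\ (exists x, p = inl x) \/
    p = inr y /\ forall x, ~ edge d (inr y) (inl x)).
  have [[x xy]|nx] := pselect (exists x, edge d (inr y) (inl x)).
    by exists (inl x); left; split=> //; exists x.
  by exists (inr y); right; split=> // x xy; apply: nx; exists x.
have s_trans x y : edge d (inl x) (inr y) -> s y = inl x.
  move/edge_sym => yx; have [[yz _]|[_ /(_ x)//]] := sP y.
  exact: edge_deg yz yx.
have s_free y : (forall x, ~ edge d (inr y) (inl x)) -> s y = inr y.
  by move=> nx; have [[yz [x e]]|[]//] := sP y; have := nx x; rewrite -e.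
have s_class y : class d (s y) = class d (inr y).
  by have [[/class_edge->]|[->]] := sP y.
pose R := rays a_skip a_link; pose S := rays b_skip b_link.
pose JR (i : X + free_lower a) : origins * nat := match i with
  | inl x => (inl (inl x), 0) | inr t => (inr (inl t), 0) end.
pose JS (i : X + free_lower (star b)) : origins * nat := match i with
  | inl y => (inl (s y), 0) | inr t => (inr (inr t), 0) end.
have mR : matching R := rays_matching a_link_matching a_link_skip.
have mS : matching S := rays_matching b_link_matching b_link_skip.
have R_JR : enumerates_unmatched R JR.
  split=> [[x|x] [y|y] [] // ->//|m].
  rewrite rays_unmatched.
  split=> [[[x|t] <-]|]; [by split=> // -[[y|y]|w]|by split=> // -[[y|y]|w]|].
  case: m => [[[x|y]|[t|t]] n] [/= -> // + nh].
  - by exists (inl x).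
  - by move=> /asboolP[z yz]; have := nh (inl (inr z)).
  - by exists (inr t).
have S_JS : enumerates_unmatched S JS.
  split=> [[x|x] [y|y] []//|m].
  - move=> e; have [[xz [z ez]]|[ex _]] := sP x; have [[yz' [z' ez']]|[ey _]] := sP y.
    + rewrite -e in yz'; by have [->] := edge_deg (edge_sym xz) (edge_sym yz').
    + by move: e; rewrite ez ey.
    + by move: e; rewrite ex ez'.
    + by move: e; rewrite ex ey => -[->].
  - by move=> ->.
  rewrite rays_unmatched.
  split=> [[[y|t] <-]|].
  - have [[yz [z e]]|[e ny]] /= := sP y; rewrite e /=.
      rewrite e in yz; split=> //.
        by apply/asboolP; exists (inr y); apply: edge_sym.
      by move=> [[w|w]|w] //= zw; have := edge_deg zw (edge_sym yz).
    by split=> //; [exact: (asboolT ny)|move=> _].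
  - by split=> // -[[y|y]|w].
  case: m => [[[x|y]|[t|t]] n] [/= -> // + nh].
  - move=> /asboolP[[z|z] xz]; first by have := nh (inl (inl z)).
    by exists (inl z) => /=; rewrite (s_trans _ _ xz).
  - by move=> /asboolP ny; exists (inl y) => /=; rewrite s_free.
  - by exists (inr t).
pose l (m : origins * nat) : set (X + X) :=
  match m.1 with inl p => class d p | inr _ => set0 end.
have rays_l k h : (forall v w, h v w ->
      exists p q, [/\ v = inl p, w = inl q & edge d p q]) ->
    forall m n, rays k h m n -> l m = l n.
  move=> hl m n [[e _ _]|[e _ _]|[_ _ /hl[p [q [mp nq pq]]]]]; rewrite /l ?e //.
  by rewrite mp nq; apply: class_edge.
apply: (@sandwich _ a b d _ (fun x => JR (inl x)) (fun y => JS (inl y)) R S l).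
- apply: right_unit_models => //.
  apply: card_eq_trans (hooks_rays_card a_link_matching a_link_skip) _.
  by rewrite card_eq_sym.
- apply: right_unit_models => //; first exact/left_units_star.
  apply: card_eq_trans (hooks_rays_card b_link_matching b_link_skip) _.
  by rewrite card_eq_sym.
- by [].
- exact: s_class.
- move=> m n []; apply: rays_l => -[[x|x]|v] [[y|y]|w] //= xy.
    by exists (inr x), (inr y).
  by exists (inl x), (inl y).
- by move=> x y xy; rewrite /JS (s_trans _ _ xy).
- by move=> x y xy; constructor 3.
- move=> x y xy; have nx z w : edge d (inr z) (inr w) -> s z = inr z.
    by move=> zw; apply: s_free => u /(edge_deg zw).
  by rewrite /JS (nx _ _ xy) (nx _ _ (edge_sym xy)); constructor 3.
Qed.

End Factorisation.

(** * Generation and rank *)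

Section Monoid.
Variable M : monoidType.
Local Open Scope group_scope.
Implicit Types x y : M.

Lemma right_units_mulr x y : right_units M (x * y) -> right_units M x.
Proof. by move=> [b xyb]; exists (y * b); rewrite mulgA. Qed.

Lemma left_units_mull x y : left_units M (x * y) -> left_units M y.
Proof. by move=> [a axy]; exists (a * x); rewrite -mulgA. Qed.

(** If [x * y] is a right unit, so is [x]; if [x] is also a left unit then it is
    invertible and can be cancelled, so that [y] is a right unit too. *)
Lemma right_units_left_subsemigroup :
  subsemigroup [set x : M | right_units M x -> left_units M x].
Proof.
move=> x y xu yu /= [b xyb].
have [a ax] : left_units M x by apply/xu/(@right_units_mulr x y); exists b.
have [c cy] : left_units M y.
  apply: yu; exists (b * x).
  have -> : y * (b * x) = a * (x * y * b) * x by rewrite !mulgA ax mul1g.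
  by rewrite xyb mulg1.
by exists (c * a); rewrite -mulgA (mulgA a) ax mul1g.
Qed.

Lemma left_units_right_subsemigroup :
  subsemigroup [set x : M | left_units M x -> right_units M x].
Proof.
move=> x y xu yu /= [a axy].
have [b yb] : right_units M y by apply/yu/(@left_units_mull x y); exists a.
have [c xc] : right_units M x.
  apply: xu; exists (y * a).
  have -> : y * a * x = y * (a * (x * y)) * b by rewrite -!mulgA yb mulg1.
  by rewrite axy mulg1.
by exists (b * c); rewrite -mulgA (mulgA y) yb mul1g.
Qed.

Lemma generated_exists (U A : set M) z : generated U = [set: M] ->
  subsemigroup A -> ~ A z -> exists2 u, U u & ~ A u.
Proof.
move=> gU sA nAz; apply: contrapT => /forall2NP UA; apply: nAz.
have : generated U z by rewrite gU.
by apply: smallest_sub => // u Uu; have [//|/contrapT] := UA u.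
Qed.

End Monoid.

Section Generation.
Variable X : Type.
Hypothesis infX : infinite_set [set: X].
Implicit Types a b : brauer X.

Lemma lower_hooks_le a : lower_hooks a #<= [set: X].
Proof.
apply: (@hooks_le _ (fun x y => edge a (inr x) (inr y))).
split=> [x y|x|x y z]; [exact: edge_sym|exact: edge_irr|].
by move=> xy /(edge_deg xy) [].
Qed.

(** The partner of [n] in the matching {0,1}, {2,3}, ... of the natural numbers. *)
Definition mate n := if odd n then n.-1 else n.+1.

Lemma mateK : involutive mate.
Proof. by rewrite /mate; case=> //= n; case o: (odd n) => /=; rewrite ?o. Qed.

Lemma mate_neq n : mate n <> n.
Proof.
rewrite /mate; case: n => //= n.
by case: (odd n) => /= /eqP; rewrite eqn_leq ltnn ?andbF.
Qed.

(** Choose disjoint sequences [g x] in the lower row, one for each upper vertex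
    [x], and match each sequence [x, g x 0, g x 1, ...] in consecutive pairs. *)
Lemma exists_right_unit_hooks :
  exists a, right_units (brauer X) a /\ [set: X] #<= lower_hooks a.
Proof.
have [g [_ ginj]] := infinite_mul_nat infX.
pose r x n : X + X := if n is m.+1 then inr (g x m) else inl x.
have rinj x y n m : r x n = r y m -> x = y /\ n = m.
  by case: n m => [|n] [|m] //= [] => [->|/ginj[]// -> ->].
pose E p q := exists x n, p = r x n /\ q = r x (mate n).
have Esym p q : E p q -> E q p.
  by move=> [x [n [-> ->]]]; exists x, (mate n); rewrite mateK.
have Eirr p : ~ E p p.
  by move=> [x [n [-> /rinj[_ /esym]]]]; apply: mate_neq.
have Edeg p q s : E p q -> E p s -> q = s.
  by move=> [x [n [-> ->]]] [y [m [/rinj[-> ->] ->]]].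
exists (Brauer Esym Eirr Edeg); split.
  by apply/right_unitP => x; exists (g x 0), x, 0.
apply: (@card_le_inj _ _ _ _ (fun x => [set g x 1; g x 2])) => [x _|x y _ _ xy].
  by exists (g x 1), (g x 2); split=> //; exists x, 2.
have : [set g y 1; g y 2] (g x 1) by rewrite -xy; left.
by case=> /ginj[].
Qed.

Lemma few_lower_hooks a : left_units (brauer X) a -> ~ ([set: X] #<= lower_hooks a).
Proof.
move=> /lower_hooks_left_unit -> le; apply: infX.
by apply: card_le_finite le _; exact: finite_set0.
Qed.

Lemma exists_right_nonleft (U : set (brauer X)) :
  generated (units (brauer X) `|` U) = [set: brauer X] ->
  exists u, [/\ U u, right_units (brauer X) u & ~ left_units (brauer X) u].
Proof.
move=> gU; have [z [rz lez]] := exists_right_unit_hooks.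
have [|u [[lu _ []//]|Uu]] :=
  generated_exists (z := z) gU (@right_units_left_subsemigroup _).
  by move=> /(_ rz) /few_lower_hooks.
by move=> /not_implyP[ru nlu]; exists u.
Qed.

Lemma exists_left_nonright (U : set (brauer X)) :
  generated (units (brauer X) `|` U) = [set: brauer X] ->
  exists u, [/\ U u, left_units (brauer X) u & ~ right_units (brauer X) u].
Proof.
move=> gU; have [z [rz lez]] := exists_right_unit_hooks.
have [|u [[_ ru []//]|Uu]] :=
  generated_exists (z := star z) gU (@left_units_right_subsemigroup _).
  rewrite /= left_units_star starK => /(_ rz) rs.
  by apply: few_lower_hooks lez; apply/left_units_star.
by move=> /not_implyP[lu nru]; exists u.
Qed.

(** The elements with fewer than |X| lower hooks form a subsemigroup, which
    contains all left units. *)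
Lemma generated_lower_hooks a b : left_units (brauer X) b ->
  generated (units (brauer X) `|` [set a; b]) = [set: brauer X] ->
  lower_hooks a #= [set: X].
Proof.
move=> lb gab; rewrite card_eq_le lower_hooks_le /=.
have [z [_ lez]] := exists_right_unit_hooks.
have [||u + /contrapT leu] := generated_exists
  (A := [set u | ~ ([set: X] #<= lower_hooks u)]) (z := z) gab.
- by move=> u v nu nv /(infinite_lower_hooks_mul infX)[].
- by apply.
by move=> [[/few_lower_hooks//]|[<-//|ub]]; case: (few_lower_hooks lb); rewrite -ub.
Qed.

Lemma generated_upper_hooks a b : right_units (brauer X) a ->
  generated (units (brauer X) `|` [set a; b]) = [set: brauer X] ->
  upper_hooks b #= [set: X].
Proof.
move=> ra gab; rewrite -lower_hooks_star card_eq_le lower_hooks_le /=.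
have [z [_ lez]] := exists_right_unit_hooks.
have few u : right_units (brauer X) u -> ~ ([set: X] #<= lower_hooks (star u)).
  by move=> ru; apply/few_lower_hooks/left_units_star; rewrite starK.
have [||u + /contrapT leu] := generated_exists
  (A := [set u | ~ ([set: X] #<= lower_hooks (star u))]) (z := star z) gab.
- by move=> u v nu nv; rewrite /= starM => /(infinite_lower_hooks_mul infX)[].
- by rewrite /= starK; apply.
by move=> [[_ /few//]|[ua|<-//]]; case: (few a ra); rewrite -ua.
Qed.

Lemma generated_by_pair a b :
  [/\ right_units (brauer X) a, left_units (brauer X) b,
      lower_hooks a #= [set: X] & upper_hooks b #= [set: X]] ->
  generated (units (brauer X) `|` [set a; b]) = [set: brauer X].
Proof.
move=> [ra lb ha hb]; apply/seteqP; split=> // d _ A [sA UA].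
have [c uc <-] := factorisation infX d ra lb ha hb.
by apply: (sA); [apply: (sA)|]; apply: UA; [right; left|left|right; right].
Qed.

End Generation.

Lemma card_set2 (T : eqType) (x y : T) : x != y -> [set x; y] #= `I_2.
Proof.
move=> xy; rewrite card_eq_le; apply/andP; split.
  apply: (@card_le_inj _ _ _ _ (fun z => (z == y : nat))) => [z _|z w].
    by rewrite /mkset; case: eqP.
  by move=> [->|->] [->|->]; rewrite ?eqxx ?(negPf xy).
apply: (@card_le_inj _ _ _ _ (fun n => if n is 0 then x else y)) => [[|n] _|].
- by left.
- by right.
by move=> [|[|n]] [|[|m]] // _ _ e; move: xy; rewrite e eqxx.
Qed.

Lemma card_ge2 T (A : set T) x y : A x -> A y -> x <> y -> `I_2 #<= A.
Proof.
move=> Ax Ay xy.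
apply: (@card_le_inj _ _ _ _ (fun n => if n is 0 then x else y)) => [[|n]|] //.
by move=> [|[|n]] [|[|m]] // _ _ e; case: xy.
Qed.

Theorem theorem4p7 (X : Type) (infX : infinite_set [set: X]) :
  relative_rank (units (brauer X)) `I_2 /\
  (forall alpha beta : brauer X,
    generated (units (brauer X) `|` [set alpha; beta]) = [set: brauer X] <->
    [/\ right_units (brauer X) alpha, left_units (brauer X) beta,
        lower_hooks alpha #= [set: X] & upper_hooks beta #= [set: X]] \/
    [/\ right_units (brauer X) beta, left_units (brauer X) alpha,
        lower_hooks beta #= [set: X] & upper_hooks alpha #= [set: X]]).
Proof.
split.
  split.
    have [a [ra lea]] := exists_right_unit_hooks infX.
    have ha : lower_hooks a #= [set: X].
      by rewrite card_eq_le lea lower_hooks_le.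
    have la : left_units (brauer X) (star a) by apply/left_units_star; rewrite starK.
    exists [set a; star a].
      by apply: (generated_by_pair infX); split=> //; rewrite -lower_hooks_star starK.
    apply: card_set2; apply/eqP => e.
    by apply: (few_lower_hooks infX _ lea); rewrite e.
  move=> U gU; have [u [Uu ru nlu]] := exists_right_nonleft infX gU.
  have [v [Uv lv nrv]] := exists_left_nonright infX gU.
  by apply: (card_ge2 Uu Uv) => e; apply: nlu; rewrite e.
move=> a b; split=> [gab|[]]; [|exact: generated_by_pair|]; last first.
  by rewrite [X in _ `|` X]setUC; exact: generated_by_pair.
have main c d : right_units (brauer X) c -> left_units (brauer X) d ->
    generated (units (brauer X) `|` [set c; d]) = [set: brauer X] ->
    [/\ right_units (brauer X) c, left_units (brauer X) d,
        lower_hooks c #= [set: X] & upper_hooks d #= [set: X]].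
  move=> rc ld gcd; split=> //.
    exact: generated_lower_hooks ld gcd.
  exact: generated_upper_hooks rc gcd.
have [u [Uu ru nlu]] := exists_right_nonleft infX gab.
have [v [Uv lv nrv]] := exists_left_nonright infX gab.
case: Uu ru nlu => -> ru nlu; case: Uv lv nrv => -> lv nrv //.
- by left; apply: main.
- by right; apply: main => //; rewrite [X in _ `|` X]setUC.
Qed.
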